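(* Let $X$ be a locally convex Hausdorff space, $K\subset X$ a convex compact subset, $T:\mathscr{C}(K)\to\mathscr{C}(K)$ a Markov operator such that $T(h)=h$ for every $h\in A(K)$, $a\ge0$, and $(\mu_n)_{n\ge1}$ a sequence of Borel probability measures on $K$. Then for every $f\in\mathscr{C}(K)$, $C_n(f)\to f$ uniformly on $K$ as $n\to\infty$, where $C_n$ is defined in the context.
   Context: $\mathscr{C}(K)$ is the space of real continuous functions on $K$; $A(K)$ is the space of continuous affine functions on $K$. A Markov operator is a positive linear operator $T$ on $\mathscr{C}(K)$ with $T(\mathbf{1})=\mathbf{1}$; $(\tilde\mu_x^T)_{x\in K}$ are the Borel probability measures with $\int_K f\,d\tilde\mu_x^T=T(f)(x)$. For $n\ge1$, $$C_n(f)(x)=\int_K\cdots\int_K f\Big(\frac{x_1+\dots+x_n+a x_{n+1}}{n+a}\Big)\,d\tilde\mu_x^T(x_1)\cdots d\tilde\mu_x^T(x_n)\,d\mu_n(x_{n+1})\quad(f\in\mathscr{C}(K),x\in K).$$ *)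

(* Defs.v *)
From HB Require Import structures.
From mathcomp Require Import all_boot all_order all_algebra.
From mathcomp Require Import all_classical all_reals all_analysis.
Set Implicit Arguments. Unset Strict Implicit. Unset Printing Implicit Defensive.
Import Order.TTheory GRing.Theory Num.Theory.
Import numFieldNormedType.Exports.
Local Open Scope classical_set_scope.
Local Open Scope ring_scope.

(* The Borel sigma-algebra of a topological space X: the sigma-algebra
   generated by the open sets.  Borel X is (convertible to) X itself. *)
Section borel_tvs.
Context (R : realType) (X : tvsType R).
Definition tvs_pointed : Type := X.
HB.instance Definition _ := Choice.on tvs_pointed.
HB.instance Definition _ := isPointed.Build tvs_pointed (0 : X).
Definition Borel : Type := g_sigma_algebraType (@open X : set (set tvs_pointed)).
End borel_tvs.
Arguments Borel {R} X.

Definition affine_on (R : realType) (X : lmodType R) (K : set X) (h : X -> R) :=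
  forall (x y : X) (l : R), K x -> K y -> 0 <= l -> l <= 1 ->
    h (l *: x + (1 - l) *: y) = l * h x + (1 - l) * h y.

Definition in_AK (R : realType) (X : tvsType R) (K : set X) (h : X -> R) :=
  {within K, continuous h} /\ affine_on K h.

(* Markov operator on C(K); elements of C(K) are represented by functions
   X -> R continuous on K (only values on K matter). *)
Definition markov_operator (R : realType) (X : tvsType R) (K : set X)
    (T : (X -> R) -> (X -> R)) :=
  [/\ (forall f : X -> R, {within K, continuous f} -> {within K, continuous (T f)}),
      (forall f g : X -> R, {within K, continuous f} -> {within K, continuous g} ->
         forall x, K x -> T (f \+ g) x = T f x + T g x),
      (forall (c : R) (f : X -> R), {within K, continuous f} ->
         forall x, K x -> T (fun y => c * f y) x = c * T f x),
      (forall f : X -> R, {within K, continuous f} -> (forall y, K y -> 0 <= f y) ->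
         forall x, K x -> 0 <= T f x) &
      (forall x, K x -> T (fun _ => 1) x = 1)].

(* Iterated integral over K^n, innermost variable first:
   iint mu K n g = \int ... \int g [:: x_1; ...; x_n] dmu(x_1) ... dmu(x_n) *)
Fixpoint iint (R : realType) (X : tvsType R)
    (mu : probability (Borel X) R) (K : set X) (n : nat) (g : seq X -> R) : R :=
  match n with
  | 0 => g [::]
  | n'.+1 => iint mu K n' (fun s => Rintegral mu K (fun y : Borel X => g (y :: s)))
  end.

Definition Cn (R : realType) (X : tvsType R) (K : set X)
    (mut : X -> probability (Borel X) R) (mun : nat -> probability (Borel X) R)
    (a : R) (n : nat) (f : X -> R) (x : X) : R :=
  Rintegral (mun n) K (fun y : Borel X =>
    iint (mut x) K n (fun s : seq X =>
      f ((n%:R + a)^-1 *: (\sum_(z <- s) z + a *: (y : X))))).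

(* Main.v *)
(** Continuous linear functionals separate the points of [X] (Hahn-Banach), so
    by compactness of [K * K] every [f] continuous on [K] satisfies
    [|f x - f y| <= e + b (x - y) (x - y)] on [K] for some continuous positive
    semidefinite symmetric bilinear form [b]. Since [T] fixes the continuous
    affine functions, [mut x] has barycenter [x]; integrating the form over the
    [n] independent variables of [Cn] therefore produces only variance terms,
    of total size O(1/n) uniformly on [K], plus the O(1/n^2) contribution of
    the variable of weight [a]. *)
Require Import Defs.
From HB Require Import structures.
From mathcomp Require Import all_boot all_order all_algebra.
From mathcomp Require Import all_classical all_reals all_analysis.
From mathcomp Require Import ring lra.
Set Implicit Arguments. Unset Strict Implicit. Unset Printing Implicit Defensive.
Import Order.TTheory GRing.Theory Num.Theory.
Import numFieldNormedType.Exports.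
Local Open Scope classical_set_scope.
Local Open Scope ring_scope.

(** * Sublinear functionals and the Hahn-Banach theorem *)

Section sublinear.
Context (R : realType) (V : lmodType R).
Implicit Types (q : V -> R) (G : V -> set R).

(** The inequality for positive [r] is all that has to be checked for infima; applying it to [r^-1]
    as well turns it into the equality of [sublinearZ]. *)
Definition sublinear q :=
  (forall x y, q (x + y) <= q x + q y) /\
  (forall r x, 0 < r -> q (r *: x) <= r * q x).

Lemma sublinear0 q : sublinear q -> q 0 = 0.
Proof.
move=> [_ qZ]; have := qZ 2 0; have := qZ 2^-1 0.
by rewrite !scaler0 invr_gt0 ltr0n => /(_ isT) + /(_ isT); lra.
Qed.

Lemma sublinearZ q r x : sublinear q -> 0 <= r -> q (r *: x) = r * q x.
Proof.
move=> sq; rewrite le_eqVlt => /predU1P[<-|r0].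
  by rewrite scale0r mul0r sublinear0.
apply/eqP; rewrite eq_le sq.2//=.
have := sq.2 r^-1 (r *: x); rewrite invr_gt0 scalerA mulVf ?gt_eqF// scale1r.
by rewrite ler_pdivlMl//; exact.
Qed.

Lemma sublinearN q x : sublinear q -> - q (- x) <= q x.
Proof.
by move=> sq; have := sq.1 x (- x); rewrite subrr (sublinear0 sq); lra.
Qed.

Lemma le_add_inf (A B : set R) c : A !=set0 -> B !=set0 ->
  (forall a b, A a -> B b -> c <= a + b) -> c <= inf A + inf B.
Proof.
move=> A0 B0 cAB; rewrite -lerBlDr; apply: lb_le_inf => // a Aa.
rewrite lerBlDr addrC -lerBlDr; apply: lb_le_inf => // b Bb.
by rewrite lerBlDr addrC cAB.
Qed.

(** Common to the three infima below: tilts, lower bounds of chains, and gauges. *)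
Lemma sublinear_inf G :
  (forall x, G x !=set0) -> (forall x, has_lbound (G x)) ->
  (forall x y a b, G x a -> G y b -> exists2 c, G (x + y) c & c <= a + b) ->
  (forall r x a, 0 < r -> G x a -> exists2 c, G (r *: x) c & c <= r * a) ->
  sublinear (fun x => inf (G x)).
Proof.
move=> G0 Glb GD GZ; split=> [x y|r x r0].
  apply: le_add_inf => // a b Ga Gb; have [c Gc] := GD _ _ _ _ Ga Gb.
  by apply: le_trans; exact: ge_inf.
rewrite mulrC -ler_pdivrMr//; apply: lb_le_inf => // a Ga.
rewrite ler_pdivrMr// mulrC; have [c Gc] := GZ _ _ _ r0 Ga.
by apply: le_trans; exact: ge_inf.
Qed.

(** A sublinear minorant of [q] (take [t = 0]) with value at most [- q y] at [- y] (take [t = 1]),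
    so that a linear functional below it must equal [q y] at [y]. *)
Definition tilt q y x :=
  inf [set a | exists2 t, 0 <= t & a = q (x + t *: y) - t * q y].

Section tilt.
Variables (q : V -> R) (y : V).
Hypothesis sq : sublinear q.

Lemma tilt_lb x t : 0 <= t -> - q (- x) <= q (x + t *: y) - t * q y.
Proof.
move=> t0; have := sq.1 (x + t *: y) (- x).
by rewrite addrAC subrr add0r sublinearZ//; lra.
Qed.

Lemma tilt_le x t : 0 <= t -> tilt q y x <= q (x + t *: y) - t * q y.
Proof.
move=> t0; apply: ge_inf; last by exists t.
by exists (- q (- x)) => _ [s s0 ->]; exact: tilt_lb.
Qed.

Lemma tilt_sublinear : sublinear (tilt q y).
Proof.
apply: sublinear_inf.
- by move=> x; exists (q (x + 0 *: y) - 0 * q y), 0.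
- by move=> x; exists (- q (- x)) => _ [s s0 ->]; exact: tilt_lb.
- move=> x z _ _ [s s0 ->] [t t0 ->].
  exists (q (x + z + (s + t) *: y) - (s + t) * q y).
    by exists (s + t) => //; exact: addr_ge0.
  by have := sq.1 (x + s *: y) (z + t *: y); rewrite scalerDl addrACA; lra.
- move=> r x _ r0 [t t0 ->].
  exists (q (r *: x + (r * t) *: y) - (r * t) * q y).
    by exists (r * t) => //; rewrite mulr_ge0// ltW.
  by rewrite -scalerA -scalerDr mulrBr mulrA lerD2r sq.2.
Qed.

Lemma tilt_le_self x : tilt q y x <= q x.
Proof. by have := @tilt_le x 0; rewrite scale0r addr0 mul0r subr0; exact. Qed.

End tilt.

(* A minimal sublinear functional [q] equals each of its tilts, so that
   [q x <= q (x + y) - q y]. *)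
Lemma minimal_sublinear_linear q : sublinear q ->
  (forall q', sublinear q' -> (forall x, q' x <= q x) -> q' = q) ->
  forall r x y, q (r *: x + y) = r * q x + q y.
Proof.
move=> sq qmin.
have qD x y : q (x + y) = q x + q y.
  apply/eqP; rewrite eq_le sq.1/=.
  have := @tilt_le q y sq x 1 ler01.
  rewrite (qmin (tilt q y)) ?scale1r ?mul1r; last first.
  - by move=> z; exact: tilt_le_self.
  - exact: tilt_sublinear.
  by rewrite lerBrDr.
have qN x : q (- x) = - q x.
  by apply/eqP; rewrite -addr_eq0 -qD addNr sublinear0.
move=> r x y; rewrite qD; congr (_ + _).
have [r0|r0] := leP 0 r; first exact: sublinearZ.
rewrite -[r]opprK scaleNr qN sublinearZ ?mulNr// oppr_ge0; exact: ltW.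
Qed.

(** Zorn's lemma for the reversed pointwise order; a nonempty chain is bounded by its pointwise
    infimum. *)
Lemma sublinear_ge_minimal p : sublinear p ->
  exists q, [/\ sublinear q, forall x, q x <= p x &
  forall q', sublinear q' -> (forall x, q' x <= q x) -> q' = q].
Proof.
move=> sp; pose P q := sublinear q /\ forall x, q x <= p x.
pose S := {q | P q}.
pose ge (s t : S) : bool := `[< forall x, sval t x <= sval s x >].
have [|||A tA|[q [sq qp]] qmin] := @Zorn S ge.
- by move=> s; apply/asboolP.
- move=> r s t /asboolP rs /asboolP st; apply/asboolP => x.
  exact: le_trans (st x) (rs x).
- move=> [s Ps] [t Pt] /asboolP/= st /asboolP/= ts.
  apply: eq_exist; apply/funext => x; apply/eqP.
  by rewrite eq_le st ts.
- have [->|/set0P[s0 As0]] := eqVneq A set0.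
    by exists (exist P p (conj sp (fun=> lexx _))).
  pose G x := [set sval s x | s in A].
  (* The infimum is finite: [s <= p] gives [- p (- x) <= - s (- x) <= s x]. *)
  have Glb x : has_lbound (G x).
    exists (- p (- x)) => _ [s _ <-]; have [ss sp'] := svalP s.
    by apply: le_trans (sublinearN x ss); rewrite lerN2.
  have sG : sublinear (fun x => inf (G x)).
    apply: sublinear_inf => //.
    + by move=> x; exists (sval s0 x), s0.
    + move=> x y _ _ [s As <-] [t At <-].
      have [ss _] := svalP s; have [st _] := svalP t.
      (* Subadditivity uses the chain: the smaller of the two functionals serves at both points. *)
      have [/asboolP le_ts|/asboolP le_st] := tA _ _ As At.
        exists (sval t (x + y)); first by exists t.
        by rewrite (le_trans (st.1 _ _))// lerD2r.
      exists (sval s (x + y)); first by exists s.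
      by rewrite (le_trans (ss.1 _ _))// lerD2l.
    + move=> r x _ r0 [s As <-]; exists (sval s (r *: x)); first by exists s.
      by have [ss _] := svalP s; exact: ss.2.
  have Gle s x : A s -> inf (G x) <= sval s x.
    by move=> As; apply: ge_inf => //; exists s.
  have Gp x : inf (G x) <= p x.
    by apply: le_trans (Gle _ _ As0) _; case: (svalP s0).
  exists (exist P _ (conj sG Gp)) => s As; by apply/asboolP => x; exact: Gle.
- exists q; split => // q' sq' q'q.
  have q'p x : q' x <= p x by exact: le_trans (qp x).
  exact: (congr1 sval (qmin (exist P q' (conj sq' q'p)) (asboolT q'q))).
Qed.

(** A minimal sublinear functional below [tilt p x0] is linear, and the tilt forces its value at
    [x0]; no extension from a subspace is involved. *)
Lemma hahn_banach_sublinear p x0 : sublinear p ->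
  exists phi : V -> R, [/\ forall r x y, phi (r *: x + y) = r * phi x + phi y,
    forall x, phi x <= p x & phi x0 = p x0].
Proof.
move=> sp.
have [phi [sphi phip phimin]] := sublinear_ge_minimal (tilt_sublinear x0 sp).
have philin := minimal_sublinear_linear sphi phimin.
have phi_le x : phi x <= p x by exact: le_trans (phip x) (tilt_le_self _ sp _).
exists phi; split => //; apply/eqP; rewrite eq_le phi_le/=.
have := le_trans (phip (- x0)) (tilt_le x0 sp (- x0) ler01).
rewrite scale1r addNr (sublinear0 sp) mul1r sub0r.
have := philin (-1) x0 0; rewrite scaleN1r addr0 (sublinear0 sphi) => ->.
lra.
Qed.

End sublinear.

(** * Separation of points by continuous linear functionals *)

Section separation.
Context (R : realType) (X : tvsType R).
Implicit Types (U : set X) (phi : X -> R).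

Definition linear_functional phi :=
  forall r x y, phi (r *: x + y) = r * phi x + phi y.

(** The Minkowski functional of [U]. *)
Definition gauge U x := inf [set t : R | 0 < t /\ U (t^-1 *: x)].

Lemma absorbing U x : nbhs 0 U -> exists2 t : R, 0 < t & U (t^-1 *: x).
Proof.
move=> U0; have /= := @scale_continuous R X (0, x) U.
rewrite scale0r => /(_ U0)[]/= B [[e /= e0 eB] B2] BU.
have norm_lt : `|(2 / e)^-1| < e.
  rewrite invf_div gtr0_norm ?divr_gt0//.
  by rewrite ltr_pdivrMr// ltr_pMr// ltr1n.
exists (2 / e); first by rewrite divr_gt0.
apply: (BU (_, _)); split => /=; last exact: nbhs_singleton.
by apply: eB; rewrite /ball_ /= sub0r normrN.
Qed.

Lemma convex_setP U x y (t : R) : convex_set U -> U x -> U y -> 0 <= t -> t <= 1 ->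
  U (t *: x + (1 - t) *: y).
Proof.
move=> cU Ux Uy t0 t1.
have t01 : Itv.spec (@Itv.num_sem R) (Itv.Real `[0%Z, 1%Z]) t.
  apply/and3P; split; rewrite ?num_real//= !bnd_simp//.
have := cU x y (Itv.mk t01); rewrite !inE => /(_ Ux Uy).
by [].
Qed.

Lemma gauge_lb U x : has_lbound [set t : R | 0 < t /\ U (t^-1 *: x)].
Proof. by exists 0 => t [/ltW]. Qed.

Lemma gauge_sublinear U : convex_set U -> nbhs 0 U -> sublinear (gauge U).
Proof.
move=> cU U0; apply: sublinear_inf.
- by move=> x; have [t] := absorbing x U0; exists t.
- exact: gauge_lb.
- move=> x y s t [s0 Us] [t0 Ut]; exists (s + t) => //; split; first exact: addr_gt0.
  have st0 : s + t != 0 by rewrite gt_eqF// addr_gt0.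
  (* The weights [s / (s + t)] and [t / (s + t)] combine [s^-1 *: x] and [t^-1 *: y] into
     [(s + t)^-1 *: (x + y)]. *)
  have := @convex_setP U _ _ (s / (s + t)) cU Us Ut.
  have -> : 1 - s / (s + t) = t / (s + t) by field.
  rewrite !scalerA !(mulrAC _ (s + t)^-1) !mulfV ?gt_eqF// !mul1r -scalerDr; apply.
    by rewrite divr_ge0// ltW// addr_gt0.
  by rewrite ler_pdivrMr ?addr_gt0// mul1r lerDl ltW.
- move=> r x t r0 [t0 Ut]; exists (r * t) => //; split; first exact: mulr_gt0.
  by rewrite invfM mulrC scalerA -mulrA mulVf ?gt_eqF// mulr1.
Qed.

Lemma gauge_le1 U x : U x -> gauge U x <= 1.
Proof. by move=> Ux; apply: ge_inf; [exact: gauge_lb|rewrite /= invr1 scale1r]. Qed.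

Lemma gauge_ge1 U x : convex_set U -> nbhs 0 U -> ~ U x -> 1 <= gauge U x.
Proof.
move=> cU U0 Ux; apply: lb_le_inf; first by have [t] := absorbing x U0; exists t.
move=> t [t0 Ut]; rewrite leNgt; apply/negP => t1; apply: Ux.
(* For [t < 1], [x] lies on the segment from [0] to [t^-1 *: x], hence in [U]. *)
have := @convex_setP U _ 0 t cU Ut (nbhs_singleton U0) (ltW t0) (ltW t1).
by rewrite scaler0 addr0 scalerA mulfV ?gt_eqF// scale1r.
Qed.

(** By homogeneity [phi <= e] on [e U]; the upper bound suffices, being applied to both [y - x] and
    [x - y]. *)
Lemma linear_functional_continuous phi U : linear_functional phi ->
  nbhs 0 U -> (forall x, U x -> phi x <= 1) -> continuous phi.
Proof.
move=> lphi U0 phiU x.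
have phi0 : phi 0 = 0.
  by have := lphi 1 0 0; rewrite scaler0 addr0; lra.
have phiZ r y : phi (r *: y) = r * phi y.
  by have := lphi r y 0; rewrite addr0 phi0 addr0.
apply/cvgrPdist_le => e e0.
have csx : (fun y => y - x) @ x --> (0 : X).
  move=> W W0; have /= := @sub_continuous X (x, x) W.
  rewrite subrr => /(_ W0)[]/= B [B1 B2] BW.
  by apply: filterS B1 => y B1y; apply: (BW (y, x)); split => //=;
    exact: nbhs_singleton.
have phie z : ( *:%R e @` U) z -> phi z <= e.
  by move=> [y Uy <-]; rewrite phiZ -ler_pdivlMl// mulVf ?gt_eqF// phiU.
have Ue : nbhs (0 : X) ( *:%R e @` U) by apply: nbhs0Z => //; rewrite gt_eqF.
near=> y.
have phiB : phi (y - x) = phi y - phi x.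
  by rewrite addrC -scaleN1r lphi mulN1r addrC.
rewrite ler_norml; apply/andP; split.
  have : phi (y - x) <= e by apply: phie; near: y; exact: csx.
  rewrite phiB; lra.
have : phi (- (y - x)) <= e.
  apply: phie; near: y.
  apply: (@filterS _ (nbhs x) _ _ _ _ (csx _ (nbhs0N Ue))).
  by move=> z [w Uw /= <-]; rewrite opprK.
rewrite -scaleN1r phiZ phiB; lra.
Unshelve. all: by end_near.
Qed.

(** Some convex open neighbourhood of 0 misses [x]; Hahn-Banach for its gauge gives a functional at
    most 1 on it and at least 1 at [x]. *)
Lemma hausdorff_separating (x : X) : hausdorff_space X -> x != 0 ->
  exists phi, [/\ linear_functional phi, continuous phi & phi x != 0].
Proof.
move=> hX x0.
have [[A B]/= [xA B0] [oA oB AB]] :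
  exists2 AB : set X * set X, x \in AB.1 /\ 0 \in AB.2 &
    [/\ open AB.1, open AB.2 & AB.1 `&` AB.2 == set0].
  by move: hX; rewrite open_hausdorff => /(_ _ _ x0).
have [BB cvx [BBo /= bas]] := @locally_convex R X.
have nB : nbhs (0 : X) B by apply: open_nbhs_nbhs; split => //; exact: set_mem.
have [U [BU U0] UB] := bas _ _ nB.
have cU : convex_set U by apply: cvx; exact: mem_set.
have nU : nbhs (0 : X) U by apply: open_nbhs_nbhs; split => //; exact: BBo.
have nUx : ~ U x.
  move=> /UB Bx; suff : (A `&` B) x by rewrite (eqP AB).
  by split => //; exact: set_mem.
have [phi [lphi phi_le phix]] := hahn_banach_sublinear x (gauge_sublinear cU nU).
exists phi; split => //.
  apply: (linear_functional_continuous lphi nU) => y Uy.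
  exact: le_trans (gauge_le1 Uy).
by rewrite phix gt_eqF// (lt_le_trans ltr01)// gauge_ge1.
Qed.
End separation.

(** * Continuous positive semidefinite forms as moduli of continuity *)

Section forms.
Context (R : realType) (X : tvsType R).
Implicit Types (b : X -> X -> R) (phi : X -> R) (K D : set X).

(** Continuity in one argument makes [b ^~ z] an affine test function; continuity on the diagonal
    gives neighbourhoods and bounds on compact sets. *)
Record cform b : Prop := Cform {
  cform_linear : forall z, linear_functional (b ^~ z) ;
  cform_sym : forall x y, b x y = b y x ;
  cform_ge0 : forall x, 0 <= b x x ;
  cform_continuous : forall z, continuous (b ^~ z) ;
  cform_diag_continuous : continuous (fun x => b x x) }.

Lemma cformDl b x y z : cform b -> b (x + y) z = b x z + b y z.
Proof. by move=> /cform_linear/(_ z 1 x y); rewrite scale1r mul1r. Qed.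

Lemma cform0l b z : cform b -> b 0 z = 0.
Proof. by move=> cb; have := cformDl 0 0 z cb; rewrite addr0; lra. Qed.

Lemma cformZl b r x z : cform b -> b (r *: x) z = r * b x z.
Proof.
by move=> cb; have := cform_linear cb z r x 0; rewrite addr0 cform0l// addr0.
Qed.

Lemma cform_diagD b x y : cform b ->
  b (x + y) (x + y) = b x x + 2 * b x y + b y y.
Proof.
move=> cb; rewrite cformDl// !(cform_sym cb _ (x + y)) !cformDl//.
by rewrite (cform_sym cb y x); ring.
Qed.

Lemma cform_diagZ b r x : cform b -> b (r *: x) (r *: x) = r ^+ 2 * b x x.
Proof. by move=> cb; rewrite cformZl// cform_sym// cformZl// mulrA. Qed.

Lemma cform_diagN b x : cform b -> b (- x) (- x) = b x x.
Proof. by move=> cb; rewrite -scaleN1r cform_diagZ// sqrrN expr1n mul1r. Qed.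

(** Parallelogram identity, with the term at [x + y] dropped. *)
Lemma cform_diagB_le b x y : cform b ->
  b (x - y) (x - y) <= 2 * b x x + 2 * b y y.
Proof.
move=> cb; have := cform_ge0 cb (x + y); rewrite !cform_diagD// cform_diagN//.
by rewrite (cform_sym cb x (- y)) -scaleN1r cformZl// (cform_sym cb y); lra.
Qed.

Lemma cform_cst0 : cform (fun _ _ => 0).
Proof.
split=> //; first by move=> z r x y; rewrite mulr0 addr0.
- by move=> z; exact: cst_continuous.
- exact: cst_continuous.
Qed.

Lemma cformD b1 b2 : cform b1 -> cform b2 -> cform (fun x y => b1 x y + b2 x y).
Proof.
move=> c1 c2; split.
- by move=> z r x y; rewrite (cform_linear c1) (cform_linear c2); ring.
- by move=> x y; rewrite (cform_sym c1) (cform_sym c2).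
- by move=> x; rewrite addr_ge0// cform_ge0.
- by move=> z x; apply: cvgD; exact: cform_continuous.
- by move=> x; apply: cvgD; exact: cform_diag_continuous.
Qed.

Lemma cformZ b (r : R) : 0 <= r -> cform b -> cform (fun x y => r * b x y).
Proof.
move=> r0 cb; split.
- by move=> z s x y; rewrite (cform_linear cb); ring.
- by move=> x y; rewrite (cform_sym cb).
- by move=> x; rewrite mulr_ge0// cform_ge0.
- by move=> z x; apply: cvgMr; exact: cform_continuous.
- by move=> x; apply: cvgMr; exact: cform_diag_continuous.
Qed.

Lemma cform_functional phi : linear_functional phi -> continuous phi ->
  cform (fun x y => phi x * phi y).
Proof.
move=> lphi cphi; split.
- by move=> z s x y; rewrite lphi; ring.
- by move=> x y; rewrite mulrC.
- by move=> x; rewrite -expr2 sqr_ge0.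
- by move=> z x; apply: cvgMl; exact: cphi.
- by move=> x; apply: cvgM; exact: cphi.
Qed.

(* The forms dominating a given one: a finite cover of [K * K] is thus handled by
   [near_covering] without summing finitely many forms explicitly. *)
Definition cform_filter : set_system (X -> X -> R) :=
  [set S | exists2 b0, cform b0 &
    forall b, cform b -> (forall z, b0 z z <= b z z) -> S b].

Lemma cform_filterP : Filter cform_filter.
Proof.
split.
- by exists (fun _ _ => 0) => //; exact: cform_cst0.
- move=> S T [b1 cb1 Sb] [b2 cb2 Tb]; exists (fun x y => b1 x y + b2 x y).
    exact: cformD.
  move=> b cb bb; split.
    by apply: Sb => // z; rewrite (le_trans _ (bb z))// lerDl cform_ge0.
  by apply: Tb => // z; rewrite (le_trans _ (bb z))// lerDr cform_ge0.
- by move=> S T ST [b0 cb0 Sb]; exists b0 => // b cb bb; exact/ST/Sb.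
Qed.

(* Uniform continuity measured by forms; unlike continuity within [D], it passes
   to partial integrals by integrating the inequality. *)
Definition form_uniform D (F : X -> R) := forall e, 0 < e ->
  exists2 b, cform b & forall x y, D x -> D y ->
    `|F x - F y| <= e + b (x - y) (x - y).

Lemma compact_continuous_bound K (f : X -> R) : compact K ->
  {within K, continuous f} -> exists2 M, 0 < M & forall x, K x -> `|f x| <= M.
Proof.
move=> cK cf.
have [M [_ /(_ (`|M| + 1))Mb]] := compact_bounded (continuous_compact cf cK).
exists (`|M| + 1); first by rewrite ltr_wpDl.
move=> x Kx; apply: Mb; last by exists x.
by rewrite ltr_pwDr// ler_norm.
Qed.

Lemma continuous_form_uniform K (f : X -> R) : hausdorff_space X -> compact K ->
  {within K, continuous f} -> form_uniform K f.
Proof.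
move=> hX cK cf e e0.
have [M M0 fM] := compact_continuous_bound cK cf.
have := compact_setX cK cK.
move=> /compact_near_coveringP/near_covering_withinP.
pose P b (p : X * X) := `|f p.1 - f p.2| <= e + b (p.1 - p.2) (p.1 - p.2).
move=> /(_ _ cform_filter P cform_filterP)[|b0 cb0 Pb]; last first.
  by exists b0 => // x y Kx Ky; exact: (Pb b0 cb0 (fun=> lexx _) (x, y)).
move=> [x y] [/= Kx Ky].
(* Near a diagonal point continuity of [f] is enough, whatever the form. Near any other point a
   large multiple of the square of a separating functional exceeds the oscillation of [f]. *)
have [<-{y Ky}|xy] := eqVneq x y.
  have e20 : 0 < e / 2 by rewrite divr_gt0.
  pose V := [set z | K z -> `|f x - f z| < e / 2].
  have xV : nbhs x V.
    by have /(_ _ Kx)/cvgrPdist_lt/(_ _ e20) := (subspace_continuousP _ _).1 cf.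
  exists (V `*` V, cform) => /=.
    split; first by exists (V, V).
    by exists (fun _ _ => 0) => //; exact: cform_cst0.
  move=> [[u v] b] /= [[/= Vu Vv] cb] [/= /Vu + /Vv].
  rewrite /V /= /P /= => fu fv.
  have := cform_ge0 cb (u - v).
  move: fu fv; rewrite !ltr_norml ler_norml => /andP[? ?] /andP[? ?] ?.
  by apply/andP; split; lra.
have [|phi [lphi cphi phixy]] := @hausdorff_separating R X (x - y) hX.
  by rewrite subr_eq0.
have phi2 : 0 < phi (x - y) ^+ 2 by rewrite exprn_even_gt0.
(* Chosen so that the form is [2 * M + 1] at [x - y]: it stays above [2 * M], a bound for
   [f u - f v], on a neighbourhood. *)
pose r := (2 * M + 1) / phi (x - y) ^+ 2.
pose b0 u v := r * (phi u * phi v).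
have cb0 : cform b0.
  apply: cformZ; last exact: cform_functional.
  by rewrite divr_ge0 ?sqr_ge0//; lra.
have b0xy : 2 * M < b0 (x - y) (x - y).
  by rewrite /b0 -expr2 /r -mulrA mulVf ?gt_eqF//; lra.
exists ([set p | 2 * M < b0 (p.1 - p.2) (p.1 - p.2)],
  [set b | cform b /\ forall z, b0 z z <= b z z]) => /=.
  split; last by exists b0.
  have /= cs := @continuous_comp _ _ _ (fun p : X * X => p.1 - p.2)
    (fun z => b0 z z) (x, y)
    (@sub_continuous X (x, y)) (@cform_diag_continuous _ cb0 _).
  exact: (cvgr_gt _ cs _ b0xy).
move=> [[u v] b] /= [ltb [cb leb]] [/= Ku Kv]; rewrite /P/=.
have := leb (u - v); have := fM _ Ku; have := fM _ Kv.
by rewrite !ler_norml => /andP[? ?] /andP[? ?] ?; apply/andP; split; lra.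
Qed.

(** As [y] tends to [x], [b (x - y) (x - y)] tends to [b 0 0 = 0]. *)
Lemma form_uniform_continuous D F : form_uniform D F -> {within D, continuous F}.
Proof.
move=> uF; apply/subspace_continuousP => x Dx; apply/cvgrPdist_lt => e e0.
have e20 : 0 < e / 2 by rewrite divr_gt0.
have [b cb bF] := uF _ e20.
have : (fun y => b (x - y) (x - y)) @ x --> b 0 0.
  rewrite -(subrr x).
  apply: (@continuous_comp _ _ _ (fun y : X => x - y) (fun z => b z z)).
    have cx : (fun y : X => (x, y)) @ x --> (x, x).
      by apply: cvg_pair; [exact: cvg_cst|exact: cvg_id].
    exact: (cvg_comp _ _ cx (@sub_continuous X (x, x))).
  exact: cform_diag_continuous.
move=> /cvgr_lt/(_ (e / 2)); rewrite cform0l// => /(_ e20).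
apply: filterS => y bxy Dy /=.
by have := bF _ _ Dx Dy; lra.
Qed.

Lemma form_uniform_comp D K F (g : X -> X) s : form_uniform K F ->
  (forall x, D x -> K (g x)) -> (forall x y, g x - g y = s *: (x - y)) ->
  form_uniform D (F \o g).
Proof.
move=> uF Kg gB e /uF[b cb bF]; exists (fun x y => s ^+ 2 * b x y).
  by apply: cformZ => //; exact: sqr_ge0.
move=> x y Dx Dy; rewrite -cform_diagZ// -gB.
by apply: bF; exact: Kg.
Qed.

End forms.

(** * Dilates of the compact set and integration over it *)

Section iterated_integrals.
Context (R : realType) (X : tvsType R) (K : set X).
Hypotheses (hX : hausdorff_space X) (cvxK : convex_set K) (cK : compact K).

(** For nonempty convex [K], the set of all sums of [n] points of [K]: the domain of the partial
    sums of the integration variables. *)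
Definition scaled (n : nat) : set X := [set n%:R *: k | k in K].

Lemma scaledD n x u : K x -> scaled n u -> scaled n.+1 (x + u).
Proof.
move=> Kx [k Kk <-]; exists (n.+1%:R^-1 *: x + (1 - n.+1%:R^-1) *: k).
  apply: convex_setP => //.
  by rewrite invf_le1 ?ltr0n// ler1n.
rewrite scalerDr !scalerA mulfV ?pnatr_eq0// scale1r mulrBr mulfV ?pnatr_eq0//.
by rewrite mulr1 -(natrB _ (ltn0Sn n)) subn1.
Qed.

Lemma scaled_mem n (a : R) y u : 0 <= a -> 0 < n%:R + a -> K y -> scaled n u ->
  K ((n%:R + a)^-1 *: (u + a *: y)).
Proof.
move=> a0 na0 Ky [k Kk <-].
have -> : (n%:R + a)^-1 *: (n%:R *: k + a *: y) =
    (n%:R / (n%:R + a)) *: k + (1 - n%:R / (n%:R + a)) *: y.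
  rewrite scalerDr !scalerA; congr (_ *: _ + _ *: _); field; exact: lt0r_neq0.
apply: convex_setP => //; first by rewrite divr_ge0// ltW.
by rewrite ler_pdivrMr// mul1r lerDl.
Qed.

Lemma compact_Borel_measurable : measurable (K : set (Borel X)).
Proof.
rewrite -[K]setCK; apply: measurableC; apply: sub_sigma_algebra.
exact/closed_openC/(compact_closed hX cK).
Qed.

Lemma continuous_Borel_measurable (f : X -> R) : {within K, continuous f} ->
  measurable_fun (K : set (Borel X)) (f : Borel X -> R).
Proof.
move=> /continuousP cf.
apply: (measurability _ (measurable_realfun.RGenOpens.measurableE R)).
move=> _ [_ [a [b ->] <-]].
have /open_subspaceP[V oV VK] :=
  cf _ (@interval_open R (BRight a) (BLeft b) isT isT).
rewrite setIC -VK; apply: measurableI; last exact: compact_Borel_measurable.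
exact: sub_sigma_algebra.
Qed.

Variable mu : probability (Borel X) R.
Hypothesis muK : mu K = 1%E.

Lemma continuous_Borel_integrable (f : X -> R) : {within K, continuous f} ->
  mu.-integrable (K : set (Borel X)) (EFin \o f).
Proof.
move=> cf; apply: measurable_bounded_integrable.
- exact: compact_Borel_measurable.
- by rewrite [X in (X < _)%E]muK ltry.
- exact: continuous_Borel_measurable.
have [M M0 fM] := compact_continuous_bound cK cf.
exists M; split; first exact: num_real.
by move=> N MN x Kx; exact: le_trans (fM _ Kx) (ltW MN).
Qed.

Lemma Rintegral_dist_le (f g h : X -> R) : {within K, continuous f} ->
  {within K, continuous g} -> {within K, continuous h} ->
  (forall y, K y -> `|f y - g y| <= h y) ->
  `|Rintegral mu K (f : Borel X -> R) - Rintegral mu K (g : Borel X -> R)| <=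
  Rintegral mu K (h : Borel X -> R).
Proof.
move=> cf cg ch fgh; have mK := compact_Borel_measurable.
have icf := continuous_Borel_integrable cf.
have icg := continuous_Borel_integrable cg.
have icfg : mu.-integrable (K : set (Borel X)) (EFin \o (fun y => f y - g y)).
  exact: (integrableB mK icf icg).
rewrite -RintegralB//; apply: le_trans (le_normr_Rintegral mK icfg) _.
apply: le_Rintegral => //.
- exact: integrable_norm.
- exact: continuous_Borel_integrable.
Qed.

Lemma Rintegral_prob_cst (r : R) : Rintegral mu K (fun _ : Borel X => r) = r.
Proof.
rewrite Rintegral_cst; last exact: compact_Borel_measurable.
by rewrite [X in fine X](_ : _ = 1%E) ?mulr1//; exact: muK.
Qed.

End iterated_integrals.

(** * Accumulation of variance in the iterated integral *)

Section iterated_bounds.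
Context (R : realType) (X : tvsType R) (K : set X).
Hypotheses (hX : hausdorff_space X) (cvxK : convex_set K) (cK : compact K).
Variable mu : probability (Borel X) R.
Hypothesis muK : mu K = 1%E.

(** Integrates out one variable [y] of a function of the sum; [u] is the sum of the remaining
    ones. *)
Let avg (F : X -> R) u := Rintegral mu K (fun y : Borel X => F (y + u)).

Lemma form_uniform_translate n F u : form_uniform (scaled K n.+1) F ->
  scaled K n u -> form_uniform K (fun y => F (y + u)).
Proof.
move=> uF nu; apply: (@form_uniform_comp _ _ _ _ _ (fun y => y + u) 1 uF).
  by move=> x Kx; exact: scaledD.
by move=> x y; rewrite scale1r opprD addrACA subrr addr0.
Qed.

(** The same form works, since translation by [y] preserves [u - v] and [mu] has mass 1. Hence every
    partial integral is again continuous. *)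
Lemma form_uniform_avg n F : form_uniform (scaled K n.+1) F ->
  form_uniform (scaled K n) (avg F).
Proof.
move=> uF e /[dup] e0 /uF[b cb bF]; exists b => // u v nu nv.
rewrite -[leRHS](Rintegral_prob_cst hX cK muK).
apply: Rintegral_dist_le => //.
- exact/form_uniform_continuous/(form_uniform_translate uF nu).
- exact/form_uniform_continuous/(form_uniform_translate uF nv).
- by move=> y; exact: cst_continuous.
move=> y Ky; have := bF (y + u) (y + v).
by rewrite opprD addrACA subrr add0r; apply; exact: scaledD.
Qed.

Lemma iint_sumS n F : iint mu K n.+1 (fun s => F (\sum_(z <- s) z)) =
  iint mu K n (fun s => avg F (\sum_(z <- s) z)).
Proof.
rewrite /=; congr iint; apply/funext => s.
by apply: eq_Rintegral => y _; rewrite big_cons.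
Qed.

Lemma iint_cst n (r : R) : iint mu K n (fun=> r) = r.
Proof.
elim: n => //= n IHn; rewrite -[RHS]IHn; congr iint.
by apply/funext => s; exact: Rintegral_prob_cst.
Qed.

Variable x : X.
Hypothesis Kx : K x.
Hypothesis bary : forall h, in_AK K h -> Rintegral mu K (h : Borel X -> R) = h x.

(* One integration replaces [b (y + v) (y + v)] by its mean, which is
   [b (x + v) (x + v)] up to the [b]-variance of [mu], bounded by [B]. *)
Lemma iint_dist_le b B n F G A c : cform b -> (forall y, K y -> b y y <= B) ->
  form_uniform (scaled K n) F -> form_uniform (scaled K n) G ->
  (forall u, scaled K n u -> `|F u - G u| <= A + b (u - c) (u - c)) ->
  `|iint mu K n (fun s => F (\sum_(z <- s) z)) -
    iint mu K n (fun s => G (\sum_(z <- s) z))| <=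
  A + n%:R * B + b (n%:R *: x - c) (n%:R *: x - c).
Proof.
move=> cb bB; elim: n F G A c => [|n IHn] F G A c uF uG FG.
  by rewrite /= big_nil mul0r addr0 scale0r; apply: FG; exists x; rewrite ?scale0r.
(* Each integration adds [B] to the constant and replaces one variable by its barycenter [x], which
   moves the centre from [c] to [c - x]. *)
rewrite !iint_sumS; have := IHn (avg F) (avg G) (A + B) (c - x).
have -> : n%:R *: x - (c - x) = n.+1%:R *: x - c.
  by rewrite opprB addrA -natr1 scalerDl scale1r addrAC.
have -> : A + B + n%:R * B = A + n.+1%:R * B by rewrite -natr1; ring.
apply; [exact: form_uniform_avg..|].
(* Expanding [b] at [y + (u - c)] and bounding [b y y] by [B] leaves a majorant affine in [y], whose
   integral is its value at [x]. *)
move=> u nu; pose w y := A + B + b (u - c) (u - c) + 2 * b y (u - c).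
have wAK : in_AK K w.
  split.
    apply: continuous_subspaceT => y; apply: cvgD; first exact: cvg_cst.
    by apply: cvgMr; exact: cform_continuous.
  by move=> y z l Ky Kz l0 l1; rewrite /w; move: (u - c) => v;
    rewrite (cformDl _ _ _ cb) !(cformZl _ _ _ cb); ring.
apply: (@le_trans _ _ (w x)).
  rewrite -bary//; apply: Rintegral_dist_le => //.
  - exact/form_uniform_continuous/(form_uniform_translate uF nu).
  - exact/form_uniform_continuous/(form_uniform_translate uG nu).
  - by case: wAK.
  move=> y Ky; apply: le_trans (FG _ (scaledD cvxK Ky nu)) _.
  by rewrite -addrA (cform_diagD _ _ cb) /w; have := bB _ Ky; lra.
rewrite opprB addrCA (cform_diagD _ _ cb) /w.
by have := cform_ge0 cb x; lra.
Qed.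

End iterated_bounds.

(** * Uniform convergence of the operators *)

Theorem theorem3p2 (R : realType) (X : tvsType R) (K : set X)
  (T : (X -> R) -> (X -> R))
  (mut : X -> probability (Borel X) R)
  (mun : nat -> probability (Borel X) R) (a : R) :
  hausdorff_space X ->
  convex_set K -> compact K ->
  markov_operator K T ->
  (forall h : X -> R, in_AK K h -> forall x, K x -> T h x = h x) ->
  (forall x, K x -> mut x K = 1%E) ->
  (forall x, K x -> forall f : X -> R, {within K, continuous f} ->
     Rintegral (mut x) K f = T f x) ->
  0 <= a ->
  (forall n, (1 <= n)%N -> mun n K = 1%E) ->
  forall f : X -> R, {within K, continuous f} ->
  forall e : R, 0 < e -> exists N : nat, forall n, (N <= n)%N -> (1 <= n)%N ->
    forall x, K x -> `|Cn K mut mun a n f x - f x| < e.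
Proof.
move=> hX cvxK cK _ TA mutK mutT a0 munK f cf e e0.
have uf := continuous_form_uniform hX cK cf.
have e20 : 0 < e / 2 by rewrite divr_gt0.
have [b cb bf] := uf _ e20.
have [B B0 bB] := compact_continuous_bound cK
  (continuous_subspaceT (cform_diag_continuous cb)).
have {}bB y : K y -> b y y <= B by move/bB; apply: le_trans; exact: ler_norm.
have C0 : 0 < (1 + 4 * a ^+ 2) * B.
  by rewrite mulr_gt0// ltr_wpDr// mulr_ge0// sqr_ge0.
(* The 1 accounts for the [n] variances, the [4 * a ^+ 2] for the variable of weight [a]; dividing
   by [n] must give less than [e / 2]. *)
exists (Num.bound ((1 + 4 * a ^+ 2) * B / (e / 2))) => n Nn n1 x Kx.
have n0 : 0 < n%:R :> R by rewrite ltr0n.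
have na0 : 0 < n%:R + a by rewrite ltr_wpDr.
pose r := (n%:R + a)^-1.
have r0 : 0 < r by rewrite invr_gt0.
pose F y u := f (r *: (u + a *: y)).
have uF y : K y -> form_uniform (scaled K n) (F y).
  move=> Ky; apply: (@form_uniform_comp _ _ _ _ _ (fun u => r *: (u + a *: y)) r uf).
    by move=> u nu; exact: scaled_mem.
  by move=> u v; rewrite -scalerBr opprD addrACA subrr addr0.
(* The inner integral as a function of the last variable, which is integrated against [mun n]. *)
pose G y := iint (mut x) K n (fun s => F y (\sum_(z <- s) z)).
have bary h : in_AK K h -> Rintegral (mut x) K (h : Borel X -> R) = h x.
  by move=> Kh; rewrite mutT ?TA//; case: Kh.
have iint_le := iint_dist_le hX cvxK cK (mutK x Kx) Kx bary.
have uG : form_uniform K G.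
  move=> d d0; have [b' cb' bf'] := uf _ d0.
  exists (fun u v => (r * a) ^+ 2 * b' u v).
    by apply: cformZ => //; exact: sqr_ge0.
  move=> y z Ky Kz.
  (* With the zero form, a bound on [F y - F z] uniform in [u] passes unchanged through the iterated
     integral. *)
  have := iint_le (fun _ _ => 0) 0 n (F y) (F z)
    (d + (r * a) ^+ 2 * b' (y - z) (y - z)) 0
    (cform_cst0 X) (fun _ _ => lexx _) (uF _ Ky) (uF _ Kz).
  rewrite mulr0 !addr0; apply => u nu; rewrite -(cform_diagZ _ _ cb').
  have := bf' _ _ (scaled_mem cvxK a0 na0 Ky nu) (scaled_mem cvxK a0 na0 Kz nu).
  by rewrite -scalerBr opprD addrACA subrr add0r -scalerBr scalerA.
have G_le y : K y -> `|G y - f x| <= e / 2 + (1 + 4 * a ^+ 2) * B / n%:R.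
  move=> Ky; have cb' : cform (fun u v => r ^+ 2 * b u v).
    by apply: cformZ => //; exact: sqr_ge0.
  (* This centre [c] satisfies [r *: (u - c) = r *: (u + a *: y) - x], and after [n] integrations
     [n%:R *: x - c] is just [a *: (y - x)]. *)
  have := iint_le _ (r ^+ 2 * B) n (F y) (fun=> f x) (e / 2)
    ((n%:R + a) *: x - a *: y) cb' _ (uF _ Ky).
  rewrite (iint_cst hX cK (mutK x Kx)).
  have -> : n%:R *: x - ((n%:R + a) *: x - a *: y) = a *: (y - x).
    by rewrite opprB scalerDl opprD addrCA [X in _ + X]addrA subrr add0r scalerBr.
  rewrite (cform_diagZ _ _ cb) => le_G; apply: (le_trans (le_G _ _ _)).
  - by move=> z Kz; rewrite ler_wpM2l ?sqr_ge0// bB.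
  - move=> d d0; exists (fun _ _ => 0); first exact: cform_cst0.
    by move=> u v _ _; rewrite subrr normr0 addr0 ltW.
  - move=> u nu; rewrite -cform_diagZ//.
    have := bf _ _ (scaled_mem cvxK a0 na0 Ky nu) Kx.
    suff -> : r *: (u - ((n%:R + a) *: x - a *: y)) =
      (n%:R + a)^-1 *: (u + a *: y) - x by [].
    by rewrite opprB addrA scalerBr scalerA mulVf ?gt_eqF// scale1r.
  have byx : b (y - x) (y - x) <= 4 * B.
    by have := cform_diagB_le y x cb; have := bB _ Ky; have := bB _ Kx; lra.
  have rn : r <= n%:R^-1 by rewrite lef_pV2 ?posrE// lerDl.
  have rn1 : r * n%:R <= 1 by rewrite mulrC ler_pdivrMr// mul1r lerDl.
  have r2n : r ^+ 2 * n%:R <= n%:R^-1.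
    rewrite expr2 -mulrA -[leRHS]mulr1; apply: ler_pM => //; first exact: ltW.
    by rewrite mulr_ge0 ?ler0n// ltW.
  (* The crude bound [1 / n] for the quadratically small term lets both errors be added. *)
  have r2 : r ^+ 2 <= n%:R^-1.
    by apply: le_trans r2n; rewrite ler_peMr ?sqr_ge0// ler1n.
  have BB : n%:R * (r ^+ 2 * B) <= n%:R^-1 * B.
    by rewrite mulrCA mulrA ler_wpM2r// ltW.
  have bB4 : r ^+ 2 * (a ^+ 2 * b (y - x) (y - x)) <= n%:R^-1 * (a ^+ 2 * (4 * B)).
    rewrite ler_pM ?sqr_ge0 ?mulr_ge0 ?sqr_ge0//; first exact: cform_ge0.
    by rewrite ler_wpM2l ?sqr_ge0.
  by move: (_^-1) BB bB4 => z BB bB4; lra.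
change (`|Rintegral (mun n) K (G : Borel X -> R) - f x| < e).
have cst_cont (c : R) : {within K, continuous (fun=> c : R)}.
  by move=> y; exact: cst_continuous.
have := Rintegral_dist_le hX cK (munK n n1) (form_uniform_continuous uG)
  (cst_cont (f x)) (cst_cont _) G_le.
rewrite !(Rintegral_prob_cst hX cK (munK n n1)) => le_C; apply: (le_lt_trans le_C).
rewrite [ltRHS](splitr e) ltrD2l ltr_pdivrMr// -ltr_pdivrMl// mulrC.
have := archi_boundP (ltW (divr_gt0 C0 e20)).
by move=> /lt_le_trans; apply; rewrite ler_nat.
Qed.
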